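(* Let $R$ be an integral domain. The following conditions are equivalent: (i) $R$ is a generalized Krull domain; (ii) $R$ is a strongly discrete P$v$MD satisfying the $t\#\#$-property; (iii) $R$ is a strongly discrete P$v$MD satisfying the $tRTP$-property.
   Context: $R$ is an integral domain with quotient field $K\neq R$. For nonzero $R$-submodules $A,B$ of $K$, $(A:B)=\{x\in K: xB\subseteq A\}$. For a nonzero fractional ideal $I$, $I_v=(R:(R:I))$, $I_t=\bigcup\{J_v: J\subseteq I\text{ nonzero finitely generated}\}$; $I$ is a $t$-ideal if $I=I_t$; a $t$-prime is a prime $t$-ideal; a $t$-maximal ideal is an ideal maximal among proper $t$-ideals. $R$ is a P$v$MD if $R_M$ is a valuation domain for every $t$-maximal $M$. A P$v$MD is strongly discrete if $(P^2)_t\neq P$ for each $t$-prime $P$ (equivalently, $R_P$ is a valuation domain with no nonzero idempotent prime ideal for each $t$-prime $P$). A generalized Krull domain is a strongly discrete P$v$MD satisfying the ascending chain condition on radical $t$-ideals. $R$ has the $t\#\#$-property if $\bigcap_{P\in\mathcal P_1}R_P\neq\bigcap_{P\in\mathcal P_2}R_P$ for any two distinct sets $\mathcal P_1,\mathcal P_2$ of pairwise incomparable $t$-primes. $R$ has the $tRTP$-property if for each nonzero ideal $I$, either $(I(R:I))_t=R$ or $(I(R:I))_t$ is a radical ideal. *)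

(* Defs.v *)
From HB Require Import structures.
From mathcomp Require Import all_boot all_algebra.
From mathcomp Require Import boolp classical_sets.
Set Implicit Arguments. Unset Strict Implicit. Unset Printing Implicit Defensive.
Import GRing.Theory.
Local Open Scope ring_scope.
Local Open Scope classical_set_scope.

(* An integral domain R is represented as a subring of a field K which is its
   quotient field (every integral domain is isomorphic to such a subring).
   Standing assumption of the paper: K <> R. *)
Definition domain_with_qf (K : fieldType) (R : set K) : Prop :=
  [/\ R 0, R 1,
      (forall x y, R x -> R y -> R (x - y)),
      (forall x y, R x -> R y -> R (x * y)) &
      (forall x : K, exists a b, [/\ R a, R b, b != 0 & x = a / b])] /\
  R <> setT.

Section Defs.
Variables (K : fieldType) (R : set K).

Definition colon (A B : set K) : set K :=
  [set x | forall b, B b -> A (x * b)].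

Definition mulsub (A B : set K) : set K :=
  [set x | exists n (a b : 'I_n -> K),
     [/\ (forall i, A (a i)), (forall i, B (b i)) & x = \sum_(i < n) a i * b i]].

Definition span n (g : 'I_n -> K) : set K :=
  [set x | exists r : 'I_n -> K, (forall i, R (r i)) /\ x = \sum_(i < n) r i * g i].

Definition vop (I : set K) : set K := colon R (colon R I).

Definition top (I : set K) : set K :=
  [set x | exists n (g : 'I_n -> K),
     [/\ span g `<=` I, span g <> [set 0] & vop (span g) x]].

Definition is_ideal (I : set K) : Prop :=
  [/\ I `<=` R, I 0, (forall x y, I x -> I y -> I (x + y)) &
      (forall r x, R r -> I x -> I (r * x))].

Definition t_ideal (I : set K) : Prop :=
  [/\ is_ideal I, I <> [set 0] & top I = I].

Definition prime_ideal (P : set K) : Prop :=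
  [/\ is_ideal P, P <> R &
      (forall a b, R a -> R b -> P (a * b) -> P a \/ P b)].

Definition t_prime (P : set K) : Prop := t_ideal P /\ prime_ideal P.

Definition t_maximal (M : set K) : Prop :=
  [/\ t_ideal M, M <> R &
      (forall N, t_ideal N -> N <> R -> M `<=` N -> N = M)].

Definition loc (P : set K) : set K :=
  [set x | exists a s, [/\ R a, R s, ~ P s & x = a / s]].

(* V (a subring of K containing R, hence with quotient field K) is a valuation
   domain *)
Definition valuation_domain (V : set K) : Prop :=
  forall x : K, x != 0 -> V x \/ V x^-1.

Definition PvMD : Prop :=
  forall M, t_maximal M -> valuation_domain (loc M).

Definition strongly_discrete_PvMD : Prop :=
  PvMD /\ (forall P, t_prime P -> top (mulsub P P) <> P).

Definition radical_ideal (I : set K) : Prop :=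
  is_ideal I /\ (forall x n, R x -> I (x ^+ n) -> I x).

Definition acc_radical_t_ideals : Prop :=
  forall I : nat -> set K,
    (forall n, t_ideal (I n) /\ radical_ideal (I n)) ->
    (forall n, I n `<=` I n.+1) ->
    exists N, forall n, (N <= n)%N -> I n = I N.

Definition generalized_Krull : Prop :=
  strongly_discrete_PvMD /\ acc_radical_t_ideals.

Definition pairwise_incomparable (S : set (set K)) : Prop :=
  forall P Q, S P -> S Q -> P `<=` Q -> P = Q.

Definition t_sharp_sharp : Prop :=
  forall P1 P2 : set (set K),
    (forall P, P1 P -> t_prime P) -> (forall P, P2 P -> t_prime P) ->
    pairwise_incomparable P1 -> pairwise_incomparable P2 ->
    P1 <> P2 ->
    \bigcap_(P in P1) loc P <> \bigcap_(P in P2) loc P.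

Definition tRTP : Prop :=
  forall I, is_ideal I -> I <> [set 0] ->
    top (mulsub I (colon R I)) = R \/ radical_ideal (top (mulsub I (colon R I))).

End Defs.

(* Main.v *)
(* All three conditions are equivalent, for a strongly discrete PvMD, to the
   following: every t-prime P contains a finite set F such that each t-prime
   containing F contains P.
   - ACC on radical t-ideals gives F, as otherwise one could enlarge F forever.
     Conversely, an ideal maximal among those failing this finiteness is a t-prime
     (as in Cohen's theorem), so all radical t-ideals satisfy it.
   - P has such an F as soon as some y outside R_P lies in R_M for all t-maximal M
     not containing P: take generators of the t-finite ideal (R : (1, y)) and an
     element generating P R_P.  The t##-property provides y by comparing
     {M | P not in M} with its union with {P}; the tRTP-property provides it in
     (R : I), where I is the trace on R of P^2 R_P.
   - Conversely F gives the t##-property, since the inverse of F is not inside R_P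
     but is inside R_Q for every t-prime Q not containing P.  The tRTP-property is
     checked locally; see radical_finite_tRTP. *)
Require Import Defs.
From HB Require Import structures.
From mathcomp Require Import all_boot all_algebra.
From mathcomp Require Import boolp classical_sets.
From mathcomp Require Import ring.
Set Implicit Arguments. Unset Strict Implicit. Unset Printing Implicit Defensive.
Import GRing.Theory.
Local Open Scope ring_scope.
Local Open Scope classical_set_scope.

(** The sets whose union with [A0] satisfies [P] are considered, so that the empty chain is settled
    by [P A0]. *)
Lemma Zorn_above (T : Type) (P : set (set T)) (A0 : set T) :
  P A0 ->
  (forall F : set (set T), F !=set0 -> F `<=` P -> total_on F subset ->
    P (\bigcup_(X in F) X)) ->
  exists A, [/\ P A, A0 `<=` A & forall B, P B -> A `<=` B -> B = A].
Proof.
move=> PA0 Pchain.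
have [F FP Ftot|A [PA Amax]] := @Zorn_bigcup T [set X | P (X `|` A0)].
  have [[X0 FX0]|F0] := pselect (F !=set0); last first.
    rewrite (_ : F = set0) ?bigcup_set0 /= ?set0U//.
    by apply/seteqP; split=> // X FX; case: F0; exists X.
  rewrite /= (_ : _ `|` _ = \bigcup_(X in [set X `|` A0 | X in F]) X).
    apply: Pchain; first by exists (X0 `|` A0), X0.
      by move=> _ [X FX <-]; exact: FP.
    move=> _ _ [X FX <-] [Y FY <-].
    by have [XY|YX] := Ftot _ _ FX FY; [left|right]; exact: setSU.
  apply/seteqP; split => [x [[X FX Xx]|A0x]|x [_ [X FX <-]] [Xx|A0x]].
  - by exists (X `|` A0); [exists X|left].
  - by exists (X0 `|` A0); [exists X0|right].
  - by left; exists X.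
  - by right.
exists (A `|` A0); split => // B PB AB.
apply/seteqP; split => // x Bx; left; apply: contrapT => Ax.
apply: (Amax B); last by rewrite /= setUidl// => y A0y; apply: AB; right.
by split=> [y Ay|/(_ x Bx)//]; apply: AB; left.
Qed.

(** * Elementary arithmetic of the domain *)

Section Domain.
Variables (K : fieldType) (R : set K).
Hypothesis HR : domain_with_qf R.

Lemma dom0 : R 0. Proof. by case: HR => -[]. Qed.
Lemma dom1 : R 1. Proof. by case: HR => -[]. Qed.
Lemma domB x y : R x -> R y -> R (x - y).
Proof. by case: HR => -[_ _ RB _ _] _; exact: RB. Qed.
Lemma domM x y : R x -> R y -> R (x * y).
Proof. by case: HR => -[_ _ _ RM _] _; exact: RM. Qed.
Lemma domN x : R x -> R (- x). Proof. by rewrite -sub0r; exact: domB dom0. Qed.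
Lemma domD x y : R x -> R y -> R (x + y).
Proof. by move=> Rx Ry; rewrite -[y]opprK; exact: domB (domN Ry). Qed.
Lemma domX x n : R x -> R (x ^+ n).
Proof. by move=> Rx; elim: n => [|n IHn]; [exact: dom1|rewrite exprS; exact: domM]. Qed.
Lemma dom_frac x : exists a b, [/\ R a, R b, b != 0 & x = a / b].
Proof. by case: HR => -[_ _ _ _ Rf] _; exact: Rf. Qed.

Lemma dom_proper : exists x, ~ R x.
Proof.
by case: HR => _ RT; apply/existsNP => Rall; apply: RT; apply/seteqP; split.
Qed.

Lemma colon_set0P y : (forall x, R (x * y)) -> y = 0.
Proof.
move=> Ry; apply/eqP; apply/negP => /negP y0; have [z] := dom_proper; apply.
by rewrite -[z](mulfVK y0).
Qed.

(** * The v-closure and t-ideals *)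

Lemma sub_vop (A : set K) : A `<=` vop R A.
Proof. by move=> a Aa b /(_ a Aa); rewrite mulrC. Qed.

(** If [b] is in [(R : B)], then [c * b] is in [(R : A)]. The case [c = 1] gives idempotence and
    monotonicity of the v-closure. *)
Lemma vop_mul (A B : set K) c x :
  (forall a, A a -> vop R B (c * a)) -> vop R A x -> vop R B (c * x).
Proof.
move=> cA Ax b Bb; rewrite -mulrA mulrCA; apply: Ax => a Aa.
by rewrite mulrAC; exact: cA.
Qed.

Lemma vop_trans (A B : set K) x :
  A `<=` vop R B -> vop R A x -> vop R B x.
Proof.
by move=> AB Ax; rewrite -[x]mul1r; apply: vop_mul Ax => a /AB; rewrite mul1r.
Qed.

Lemma vopS (A B : set K) : A `<=` B -> vop R A `<=` vop R B.
Proof. by move=> AB x; apply: vop_trans => a /AB; exact: sub_vop. Qed.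

Lemma vop_sub_dom (A : set K) : A `<=` R -> vop R A `<=` R.
Proof. by move=> AR x /(_ 1); rewrite mulr1; apply => a /AR; rewrite mul1r. Qed.

Lemma vop0 (A : set K) : vop R A 0.
Proof. by move=> b _; rewrite mul0r; exact: dom0. Qed.

Lemma vopD (A : set K) x y : vop R A x -> vop R A y -> vop R A (x + y).
Proof. by move=> Ax Ay b Ab; rewrite mulrDl; apply: domD; [exact: Ax|exact: Ay]. Qed.

Lemma vopZ (A : set K) r x : R r -> vop R A x -> vop R A (r * x).
Proof. by move=> Rr Ax b Ab; rewrite -mulrA; apply: domM => //; exact: Ax. Qed.

Lemma mem_span n (g : 'I_n -> K) i : Defs.span R g (g i).
Proof.
exists (fun j => (j == i)%:R); split.
  by move=> j; case: eqP => _; [exact: dom1|exact: dom0].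
rewrite (bigD1 i) //= eqxx mul1r big1 ?addr0 // => j /negbTE ->.
by rewrite mul0r.
Qed.

(** The dual depends only on generators, so finite sequences can replace finitely generated
    submodules. *)
Lemma vop_span n (g : 'I_n -> K) :
  vop R (Defs.span R g) = vop R [set` [seq g i | i <- enum 'I_n]].
Proof.
apply/seteqP; split; last first.
  by apply: vopS => _ /= /mapP[i _ ->]; exact: mem_span.
move=> x; apply: vop_trans => _ [r [Rr ->]].
apply: big_ind => [|y z|i _]; [exact: vop0|exact: vopD|].
apply: vopZ => //; apply: sub_vop; rewrite /= map_f//.
by rewrite mem_enum.
Qed.

Lemma ideal_neq0 (I : set K) : is_ideal R I -> I <> [set 0] ->
  exists2 x, I x & x != 0.
Proof.
move=> [_ I0 _ _] In0; apply: contrapT => nI; apply: In0.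
apply/seteqP; split => [x Ix|_ ->//]; apply/eqP/negP => /negP x0.
by apply: nI; exists x.
Qed.

Lemma neq0_set (I : set K) x : I x -> x != 0 -> I <> [set 0].
Proof. by move=> Ix /eqP x0 I0; apply: x0; rewrite I0 in Ix. Qed.

Lemma topP (I : set K) x : is_ideal R I -> I <> [set 0] ->
  top R I x <-> exists2 F : seq K, [set` F] `<=` I & vop R [set` F] x.
Proof.
move=> Iid In0; split=> [[n [g [gI _]]]|[F FI Fx]].
  rewrite vop_span => gx; exists [seq g i | i <- enum 'I_n] => // _ /mapP[i _ ->].
  by apply: gI; exact: mem_span.
have [p Ip p0] := ideal_neq0 Iid In0.
(* The nonzero [p] is added because [top] asks for a nonzero span, while [F] may contain only
   zeros. *)
pose G := p :: F; exists (size G), (fun i => G`_i); split.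
- case: Iid => [_ I0 ID IM] _ [r [Rr ->]].
  apply: big_ind => // i _; apply: IM => //.
  have : G`_i \in G by rewrite mem_nth.
  by rewrite inE => /orP[/eqP->//|]; exact: FI.
- apply: (@neq0_set _ p) => //.
  exact: (mem_span (fun i : 'I_(size G) => G`_i) ord0).
- rewrite vop_span; apply: vopS Fx => y /= Fy.
  rewrite (_ : map _ _ = G) ?inE ?Fy ?orbT//.
  by rewrite -[RHS](mkseq_nth 0) /mkseq -val_enum_ord -map_comp.
Qed.

Lemma t_idealP (I : set K) : t_ideal R I <->
  [/\ is_ideal R I, (exists2 x, I x & x != 0) &
      forall F : seq K, [set` F] `<=` I -> vop R [set` F] `<=` I].
Proof.
split=> [[Iid In0 It]|[Iid [p Ip p0] Iv]].
  split=> //; first exact: ideal_neq0.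
  by move=> F FI x Fx; rewrite -It; apply/topP => //; exists F.
have In0 := neq0_set Ip p0; split=> //; apply/seteqP; split => x.
  by move=> /(topP _ Iid In0)[F /Iv]; apply.
move=> Ix; apply/topP => //; exists [:: x]; last by apply: sub_vop; rewrite /= inE.
by move=> y /=; rewrite inE => /eqP->.
Qed.

Lemma sub_top (I : set K) : is_ideal R I -> I <> [set 0] -> I `<=` top R I.
Proof.
move=> Iid In0 x Ix; apply/topP => //; exists [:: x].
  by move=> y /=; rewrite inE => /eqP->.
by apply: sub_vop; rewrite /= inE.
Qed.

Lemma top_sub (I T : set K) : is_ideal R I -> I <> [set 0] -> t_ideal R T ->
  I `<=` T -> top R I `<=` T.
Proof.
move=> Iid In0 /t_idealP[_ _ Tv] IT x /topP[]// F FI; apply: Tv.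
exact: subset_trans IT.
Qed.

Lemma mulsubM (A B : set K) a b : A a -> B b -> mulsub A B (a * b).
Proof. by move=> Aa Bb; exists 1, (fun=> a), (fun=> b); rewrite big_ord1. Qed.

Lemma mulsub_sub (A B C : set K) : C 0 -> (forall x y, C x -> C y -> C (x + y)) ->
  (forall a b, A a -> B b -> C (a * b)) -> mulsub A B `<=` C.
Proof.
move=> C0 CD CM _ [n [a [b [Aa Bb ->]]]].
by apply: big_ind => // i _; exact: CM.
Qed.

Lemma mulsub_ideal (A B : set K) : is_ideal R A ->
  (forall a b, A a -> B b -> R (a * b)) -> is_ideal R (mulsub A B).
Proof.
move=> [_ _ _ AM] ABR; split.
- by apply: mulsub_sub => //; [exact: dom0|exact: domD].
- by exists 0, (fun=> 0), (fun=> 0); split; [case|case|rewrite big_ord0].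
- move=> _ _ [n [a [b [Aa Bb ->]]]] [m [c [d [Ac Bd ->]]]].
  pose cat (f : 'I_n -> K) (g : 'I_m -> K) (i : 'I_(n + m)) : K :=
    match split i with inl j => f j | inr k => g k end.
  exists (n + m), (cat a c), (cat b d); split=> [i|i|]; rewrite /cat; try by case: split.
  rewrite big_split_ord; congr (_ + _); apply: eq_bigr => i _.
    by rewrite (unsplitK (inl i)).
  by rewrite (unsplitK (inr i)).
- move=> r _ Rr [n [a [b [Aa Bb ->]]]]; exists n, (fun i => r * a i), b; split=> //.
    by move=> i; exact: AM.
  by rewrite mulr_sumr; apply: eq_bigr => i _; rewrite mulrA.
Qed.

(** Finite choice: the witness lists are concatenated, which monotonicity in the list allows. *)
Lemma seq_collect (T : eqType) (A : set T) (P : T -> seq T -> Prop) (F : seq T) :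
  (forall x (G H : seq T), P x G -> {subset G <= H} -> P x H) ->
  (forall x, x \in F -> exists2 G, [set` G] `<=` A & P x G) ->
  exists2 G, [set` G] `<=` A & forall x, x \in F -> P x G.
Proof.
move=> Pmono; elim: F => [|x F IHF] FG; first by exists [::].
have [|G GA FP] := IHF; first by move=> y Fy; apply: FG; rewrite inE Fy orbT.
have [|H HA xP] := FG x; first by rewrite inE eqxx.
exists (H ++ G); first by move=> y /=; rewrite mem_cat => /orP[/HA|/GA].
move=> y; rewrite inE => /orP[/eqP->|Fy].
  by apply: Pmono xP _ => z; rewrite mem_cat => ->.
by apply: Pmono (FP _ Fy) _ => z; rewrite mem_cat => ->; rewrite orbT.
Qed.

Lemma vop_seq_collect (A : set K) (F : seq K) :
  (forall x, x \in F -> exists2 G : seq K, [set` G] `<=` A & vop R [set` G] x) ->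
  exists2 G : seq K, [set` G] `<=` A & vop R [set` F] `<=` vop R [set` G].
Proof.
move=> FG; have [|G GA FvG] := @seq_collect _ A (fun x G => vop R [set` G] x) F _ FG.
  by move=> x G H Gx GH; exact: vopS Gx.
by exists G => // x; apply: vop_trans.
Qed.

(** The main point is idempotence: a finite subset of the t-closure lies in the v-closure of a
    single finite subset of [I]. *)
Lemma top_t_ideal (I : set K) : is_ideal R I -> I <> [set 0] ->
  t_ideal R (top R I).
Proof.
move=> Iid In0; have [p Ip p0] := ideal_neq0 Iid In0.
have [IR I0 ID IM] := Iid.
apply/t_idealP; split; last 1 first.
- move=> F FI x Fx; have [y Fy|G GI FG] := @vop_seq_collect I F.
    by apply/topP => //; exact: FI.
  by apply/topP => //; exists G => //; exact: FG.
- split=> [x /topP[]// F FI Fx||x y|r x Rr].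
  + by apply: vop_sub_dom Fx; exact: subset_trans IR.
  + exact: sub_top.
  + move=> /topP[]// F FI Fx /topP[]// G GI Gy; apply/topP => //.
    exists (F ++ G); first by move=> z /=; rewrite mem_cat => /orP[/FI|/GI].
    by apply: vopD; [apply: vopS Fx|apply: vopS Gy] => z /=; rewrite mem_cat => ->;
      rewrite ?orbT.
  + move=> /topP[]// F FI Fx; apply/topP => //.
    by exists F => //; exact: vopZ.
- by exists p => //; exact: sub_top.
Qed.

(** * Chains of ideals and t-maximal ideals *)

Lemma ideal_full (I : set K) : is_ideal R I -> I 1 -> I = R.
Proof.
move=> [IR _ _ IM] I1; apply/seteqP; split => // x Rx.
by rewrite -[x]mulr1; exact: IM.
Qed.

Lemma ideal_proper (I : set K) : is_ideal R I -> I <> R <-> ~ I 1.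
Proof.
move=> Iid; split=> [IR /(ideal_full Iid)//|I1 IR]; apply: I1.
by rewrite IR; exact: dom1.
Qed.

Lemma chain_seq (T : eqType) (C : set (set T)) (F : seq T) : C !=set0 ->
  total_on C subset -> [set` F] `<=` \bigcup_(X in C) X ->
  exists2 X, C X & [set` F] `<=` X.
Proof.
move=> C0 Ctot; elim: F => [|x F IHF] FC; first by case: C0 => X; exists X.
have [|X CX FX] := IHF; first by move=> y Fy; apply: FC; rewrite /= inE; apply/orP; right.
have [|Y CY Yx] := FC x; first by rewrite /= inE eqxx.
have [XY|YX] := Ctot _ _ CX CY.
  by exists Y => // y /=; rewrite inE => /orP[/eqP->//|/FX /XY].
by exists X => // y /=; rewrite inE => /orP[/eqP->//|/FX//]; exact: YX.
Qed.

Lemma ideal_bigcup (C : set (set K)) : C !=set0 -> total_on C subset ->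
  (forall X, C X -> is_ideal R X) -> is_ideal R (\bigcup_(X in C) X).
Proof.
move=> [X0 CX0] Ctot Cid; split=> [x [X /Cid[XR _ _ _] /XR]//||x y|r x Rr].
- by exists X0 => //; case: (Cid _ CX0).
- move=> [X CX Xx] [Y CY Yy]; have [_ _ XD _] := Cid _ CX; have [_ _ YD _] := Cid _ CY.
  by have [XY|YX] := Ctot _ _ CX CY;
    [exists Y => //; apply: YD => //; exact: XY|exists X => //; apply: XD => //; exact: YX].
- by move=> [X CX Xx]; exists X => //; case: (Cid _ CX) => _ _ _; apply.
Qed.

(** The closure condition concerns finite subsets, each of which lies in one member of the chain. *)
Lemma t_ideal_bigcup (C : set (set K)) : C !=set0 -> total_on C subset ->
  (forall X, C X -> t_ideal R X) -> t_ideal R (\bigcup_(X in C) X).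
Proof.
move=> C0 Ctot Ct; apply/t_idealP; split.
- by apply: ideal_bigcup => // X /Ct[].
- case: C0 => X CX; have /t_idealP[_ [x Xx x0] _] := Ct _ CX.
  by exists x => //; exists X.
- move=> F /(chain_seq C0 Ctot)[X CX FX] x Fx; exists X => //.
  by have /t_idealP[_ _ Xv] := Ct _ CX; exact: Xv Fx.
Qed.

Lemma t_maximal_exists (I : set K) : t_ideal R I -> ~ I 1 ->
  exists2 M, t_maximal R M & I `<=` M.
Proof.
move=> It I1.
have [//|F F0 FP Ftot|M [[Mt M1] IM Mmax]] :=
    @Zorn_above _ [set X | t_ideal R X /\ ~ X 1] I.
  split; first by apply: t_ideal_bigcup => // X /FP[].
  by case=> X /FP[].
exists M => //; split=> //; first by apply/ideal_proper => //; case: Mt.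
move=> N Nt NR MN; apply: Mmax => //; split=> //.
by apply/ideal_proper => //; case: Nt.
Qed.

Lemma t_ideal_colon (T : set K) x : t_ideal R T ->
  t_ideal R [set r | R r /\ T (r * x)].
Proof.
move=> /t_idealP[[TR T0 TD TM] [p Tp p0] Tv].
apply/t_idealP; split.
- split=> [r []//||r s [Rr Tr] [Rs Ts]|r s Rr [Rs Ts]] /=.
  + by split; [exact: dom0|rewrite mul0r].
  + by split; [exact: domD|rewrite mulrDl; exact: TD].
  + by split; [exact: domM|rewrite -mulrA; exact: TM].
- have [a [b [Ra Rb b0 ->]]] := dom_frac x.
  (* Multiplication by [x = a / b] sends [b * p] to [a * p], which is in [T]. *)
  exists (b * p); last by rewrite mulf_neq0.
  split; first by apply: domM => //; exact: TR.
  by rewrite (_ : b * p * (a / b) = a * p); [exact: TM|field].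
- move=> F FT r Fr; split; first by apply: vop_sub_dom Fr => f /FT[].
  apply: (Tv [seq x * f | f <- F]).
    by move=> _ /= /mapP[f /FT[_ Tf] ->]; rewrite mulrC.
  rewrite mulrC; apply: vop_mul Fr => f Ff; apply: sub_vop.
  exact: map_f.
Qed.

Lemma t_ideal_dom : t_ideal R R.
Proof.
apply/t_idealP; split; first by split; [|exact: dom0|exact: domD|exact: domM].
  by exists 1; [exact: dom1|exact: oner_neq0].
by move=> F; exact: vop_sub_dom.
Qed.

(** Otherwise the conductor of [x] into [T] would be a proper t-ideal, hence inside a t-maximal [M],
    against the local witness [s]. *)
Lemma t_ideal_local (T : set K) x : t_ideal R T ->
  (forall M, t_maximal R M -> exists s, [/\ R s, ~ M s & T (s * x)]) -> T x.
Proof.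
move=> Tt Tloc; have At := t_ideal_colon x Tt.
have [[_]|A1] := pselect ([set r | R r /\ T (r * x)] 1); first by rewrite mul1r.
have [M Mmax AM] := t_maximal_exists At A1.
by have [s [Rs Ms Ts]] := Tloc _ Mmax; case: Ms; exact: AM.
Qed.

(** For [a] outside [M], the conductor of [a] into [M] is a proper t-ideal containing [M], hence
    equal to [M]. *)
Lemma t_maximal_prime (M : set K) : t_maximal R M -> t_prime R M.
Proof.
move=> [Mt MR Mmax]; split=> //; split=> //; first by case: Mt.
move=> a b Ra Rb Mab; have [Ma|Ma] := pselect (M a); first by left.
right; pose N := [set r | R r /\ M (r * a)].
have [[MsR M0 MD MM] _ _] := Mt.
suff -> : M = N by split => //; rewrite mulrC.
apply/esym/Mmax; first exact: t_ideal_colon.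
- apply/ideal_proper; first by case: (t_ideal_colon a Mt).
  by case=> _; rewrite mul1r.
- by move=> r Mr; split; [exact: MsR|rewrite mulrC; exact: MM].
Qed.

Lemma t_prime_maximal (P : set K) : t_prime R P ->
  exists2 M, t_maximal R M & P `<=` M.
Proof.
move=> [Pt [Pid PR _]]; apply: t_maximal_exists => //.
exact/ideal_proper.
Qed.

(** * Localizations *)

Section Prime.
Variable P : set K.
Hypothesis Pp : prime_ideal R P.

Lemma prime_sub : P `<=` R. Proof. by case: Pp => -[]. Qed.
Lemma prime0 : P 0. Proof. by case: Pp => -[]. Qed.
Lemma prime_mull r x : R r -> P x -> P (r * x).
Proof. by case: Pp => -[_ _ _ PM] _ _; exact: PM. Qed.
Lemma prime_mulr r x : R r -> P x -> P (x * r).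
Proof. by rewrite mulrC; exact: prime_mull. Qed.
Lemma prime_add x y : P x -> P y -> P (x + y).
Proof. by case: Pp => -[_ _ PD _] _ _; exact: PD. Qed.
Lemma prime1 : ~ P 1.
Proof. by case: Pp => Pid PR _; apply/ideal_proper. Qed.
Lemma prime_or a b : R a -> R b -> P (a * b) -> P a \/ P b.
Proof. by case: Pp => _ _; apply. Qed.
Lemma prime_mulN a b : R a -> R b -> ~ P a -> ~ P b -> ~ P (a * b).
Proof. by move=> Ra Rb Pa Pb /prime_or[]. Qed.
Lemma prime_exp x n : R x -> P (x ^+ n) -> P x.
Proof.
move=> Rx; elim: n => [/prime1//|n IHn]; rewrite exprS.
by move=> /prime_or[]//; exact: domX.
Qed.
Lemma notin_prime_neq0 s : ~ P s -> s != 0.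
Proof. by move=> Ps; apply/eqP => s0; apply: Ps; rewrite s0; exact: prime0. Qed.

Lemma sub_loc : R `<=` loc R P.
Proof.
by move=> x Rx; exists x, 1; split; [|exact: dom1|exact: prime1|rewrite divr1].
Qed.

Lemma locV s : R s -> ~ P s -> loc R P s^-1.
Proof. by move=> Rs Ps; exists 1, s; split; [exact: dom1|..|rewrite div1r]. Qed.

Lemma locM x y : loc R P x -> loc R P y -> loc R P (x * y).
Proof.
move=> [a [s [Ra Rs Ps ->]]] [b [t [Rb Rt Pt ->]]].
exists (a * b), (s * t); split; [exact: domM|exact: domM|exact: prime_mulN|].
by rewrite mulf_div.
Qed.

Lemma locD x y : loc R P x -> loc R P y -> loc R P (x + y).
Proof.
move=> [a [s [Ra Rs Ps ->]]] [b [t [Rb Rt Pt ->]]].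
exists (a * t + b * s), (s * t); split; [|exact: domM|exact: prime_mulN|].
  by apply: domD; exact: domM.
by rewrite addf_div//; exact: notin_prime_neq0.
Qed.

Lemma loc_denom x : loc R P x -> exists s, [/\ R s, ~ P s & R (s * x)].
Proof.
move=> [a [s [Ra Rs Ps ->]]]; exists s; split=> //.
by rewrite mulrCA divff ?mulr1//; exact: notin_prime_neq0.
Qed.

Lemma locP x s : R s -> ~ P s -> R (s * x) -> loc R P x.
Proof.
move=> Rs Ps Rsx; exists (s * x), s; split=> //.
by rewrite mulrAC divff ?mul1r//; exact: notin_prime_neq0.
Qed.

Lemma loc_nonunit x : P x -> x != 0 -> ~ loc R P x^-1.
Proof.
move=> Px x0 [a [s [Ra Rs Ps /(congr1 (fun z => x * z))]]].
rewrite mulfV// mulrA => /(congr1 (fun z => z * s)).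
rewrite mul1r mulfVK; last exact: notin_prime_neq0.
by move=> sE; apply: Ps; rewrite sE; exact: prime_mulr.
Qed.

End Prime.

Lemma locS (P Q : set K) : Q `<=` P -> loc R P `<=` loc R Q.
Proof. by move=> QP x [a [s [Ra Rs Ps ->]]]; exists a, s; split=> // /QP. Qed.


(** * Valuation localizations: finite sets, comparable primes and overrings *)

Section Valuation.
Variable P : set K.
Hypotheses (Pp : prime_ideal R P) (Pval : valuation_domain (loc R P)).

(** In a valuation domain one element of a finite set divides all the others; the nonzero head [c0]
    ensures that it can be chosen nonzero. *)
Lemma loc_dominant (c0 : K) (F : seq K) : c0 != 0 ->
  exists c, [/\ c \in c0 :: F, c != 0 & forall f, f \in c0 :: F -> loc R P (f / c)].
Proof.
move=> c00; elim: F => [|f F [c [cF c0' Fc]]].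
  exists c0; split; rewrite ?inE ?eqxx// => f; rewrite inE => /eqP ->.
  by rewrite divff//; exact: (sub_loc Pp dom1).
have inE' g : g \in c0 :: f :: F -> g = f \/ g \in c0 :: F.
  by rewrite !inE => /or3P[->|/eqP|->]; [right|left|right; rewrite orbT].
have inI g : g \in c0 :: F -> g \in c0 :: f :: F.
  by rewrite !inE => /orP[->|->] //; rewrite !orbT.
have [f0|f0] := eqVneq f 0.
  exists c; split; rewrite ?inI// => g /inE'[->|/Fc//].
  by rewrite f0 mul0r; exact: (sub_loc Pp dom0).
have [fc|] := Pval (mulf_neq0 f0 (invr_neq0 c0')).
  by exists c; split; rewrite ?inI// => g /inE'[->|/Fc].
rewrite invf_div => cf; exists f; split; rewrite ?inE ?eqxx ?orbT// => g.
move=> /inE'[->|/Fc gc]; first by rewrite divff//; exact: (sub_loc Pp dom1).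
by rewrite -[g](divfK c0') -[_ / f]mulrA; exact: (locM Pp gc cf).
Qed.

Lemma loc_common_denom (F : seq K) : [set` F] `<=` loc R P ->
  exists s, [/\ R s, ~ P s & forall f, f \in F -> R (s * f)].
Proof.
elim: F => [|f F IHF] FP; first by exists 1; split => //; [exact: dom1|exact: prime1].
have [|s [Rs Ps sF]] := IHF; first by move=> g Fg; apply: FP; rewrite /= inE; apply/orP; right.
have [|t [Rt Pt tf]] := loc_denom Pp (FP f _); first by rewrite /= inE eqxx.
exists (s * t); split; [exact: domM|exact: (prime_mulN Pp)|move=> g].
rewrite inE => /orP[/eqP ->|Fg]; first by rewrite -mulrA; exact: domM.
by rewrite mulrAC; apply: domM => //; exact: sF.
Qed.

(** Here [c] divides all of [F] locally, and [s] clears the denominators of the quotients [f / c].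
    So [(R : F)] contains the local inverse [1 / c] up to a local unit. *)
Lemma loc_dual (F : seq K) p : p \in F -> p != 0 ->
  exists c s, [/\ c \in F, c != 0, R s, ~ P s & colon R [set` F] (s / c)].
Proof.
move=> Fp p0; have [c [cF c0 Fc]] := loc_dominant F p0.
have [|s [Rs Ps sF]] := @loc_common_denom [seq f / c | f <- F].
  by move=> _ /= /mapP[f Ff ->]; apply: Fc; rewrite inE Ff orbT.
exists c, s; split=> //; first by move: cF; rewrite inE => /orP[/eqP ->|].
by move=> f Ff; rewrite mulrAC -mulrA; apply: sF; exact: map_f.
Qed.

(** The primes inside [P] form a chain: one of [x / y] and [y / x] lies in the valuation ring. *)
Lemma valuation_comparable (A B : set K) x y : prime_ideal R A -> prime_ideal R B ->
  A `<=` P -> B `<=` P -> A x -> ~ B x -> B y -> A y.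
Proof.
move=> Ap Bp AP BP Ax Bx By; apply: contrapT => Ay.
have Rx := prime_sub Ap Ax; have Ry := prime_sub Bp By.
have x0 := notin_prime_neq0 Bp Bx; have y0 := notin_prime_neq0 Ap Ay.
have [|] := Pval (mulf_neq0 x0 (invr_neq0 y0)); rewrite ?invf_div;
    move=> /(loc_denom Pp)[s [Rs Ps Rsq]].
- have : B (s * x).
    by rewrite -[x](divfK y0) mulrA; exact: (prime_mull Bp).
  by move=> /(prime_or Bp Rs Rx)[/BP|].
- have : A (s * y).
    by rewrite -[y](divfK x0) mulrA; exact: (prime_mull Ap).
  by move=> /(prime_or Ap Rs Ry)[/AP|].
Qed.

Variable W : set K.
Hypotheses (PW : loc R P `<=` W) (WD : forall x y, W x -> W y -> W (x + y)).
Hypothesis (WM : forall x y, W x -> W y -> W (x * y)).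

(** The nonunits of [W] lying in [R]. Zero is listed apart because [0^-1] is [0] by convention,
    hence in [W]. *)
Definition center : set K := [set r | R r /\ (r = 0 \/ ~ W r^-1)].

Let RW : R `<=` W. Proof. by move=> x Rx; exact: PW (sub_loc Pp Rx). Qed.

Lemma center_sub : center `<=` P.
Proof.
move=> r [Rr [->|Wr]]; first exact: prime0 Pp.
by apply: contrapT => Pr; apply: Wr; apply: PW; exact: locV.
Qed.

Lemma notin_center r : R r -> ~ center r -> W r^-1.
Proof. by move=> Rr cr; apply: contrapT => Wr; apply: cr; split=> //; right. Qed.

Lemma center_prime : prime_ideal R center.
Proof.
have addc r s : R r -> R s -> W (r / s) -> center r -> center s -> center (r + s).
  move=> Rr Rs Wrs cr [_ cs]; split; first exact: domD.
  have [->|rs0] := eqVneq (r + s) 0; [by left|right=> Wd].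
  have [s0|s0] := eqVneq s 0.
    by case: cr Wd => _ [r0|]; [case/eqP: rs0; rewrite r0 s0 addr0|rewrite s0 addr0].
  case: cs => [/eqP|]; [by rewrite (negbTE s0)|apply].
  rewrite (_ : s^-1 = (r / s + 1) * (r + s)^-1); last by field; rewrite ?s0 ?rs0.
  by apply: WM Wd; apply: WD Wrs _; exact: RW dom1.
have cid : is_ideal R center.
  split=> [r []//||r s cr cs|r s Rr [Rs cs]].
  - by split; [exact: dom0|left].
  - have [Rr _] := cr; have [Rs _] := cs.
    have [r0|r0] := eqVneq r 0; first by rewrite r0 add0r.
    have [s0|s0] := eqVneq s 0; first by rewrite s0 addr0.
    have [/PW rs|] := Pval (mulf_neq0 r0 (invr_neq0 s0)); first exact: addc.
    by rewrite invf_div addrC => /PW sr; exact: addc.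
  - split; first exact: domM.
    have [->|r0] := eqVneq r 0; first by left; rewrite mul0r.
    case: cs => [->|Ws]; [by left; rewrite mulr0|right=> Wrs; apply: Ws].
    by rewrite -[s^-1](mulVKf r0) -invfM; apply: WM => //; exact: RW.
split=> //.
  apply/ideal_proper => // -[_ [/eqP|]]; first by rewrite oner_eq0.
  by rewrite invr1; apply; exact: RW dom1.
move=> a b Ra Rb [_ cab].
have [ca|/(notin_center Ra) Wa] := pselect (center a); first by left.
have [cb|/(notin_center Rb) Wb] := pselect (center b); first by right.
case: cab => [/eqP|[]]; last by rewrite invfM; exact: WM.
rewrite mulf_eq0 => /orP[]/eqP->; [left|right]; split; [exact: dom0|by left|exact: dom0|by left].
Qed.

(** An overring of a valuation domain is a localization. If [w^-1] is in [loc R P], then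
    [w = s / (s / w)], and [s / w] is outside the center since its inverse [w / s] is in [W]. *)
Lemma loc_center : loc R center = W.
Proof.
apply/seteqP; split=> [_ [a [s [Ra Rs cs ->]]]|w Ww].
  by apply: WM; [exact: RW|exact: notin_center].
have [->|w0] := eqVneq w 0; first exact: (sub_loc center_prime dom0).
have [|/(loc_denom Pp)[s [Rs Ps Rsw]]] := Pval w0; first exact: (locS center_sub).
have s0 := notin_prime_neq0 Pp Ps.
exists s, (s / w); split; rewrite ?invf_div//; last by rewrite mulrC divfK.
move=> [_ [/eqP|]]; first by rewrite mulf_eq0 invr_eq0 (negbTE s0) (negbTE w0).
rewrite invf_div; apply; apply: WM => //.
by apply: PW; exact: locV.
Qed.

End Valuation.

(** * The t-primes of a PvMD *)

Section PvMD.
Hypothesis pv : PvMD R.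

(** The v-closure of a finite set adds nothing at [M]: with [c] and [s] from [loc_dual], [s * y] is
    a multiple of [c], hence in [Q], while [s] is outside [M]. *)
Lemma prime_t_prime (M Q : set K) x : t_maximal R M -> prime_ideal R Q ->
  Q `<=` M -> Q x -> x != 0 -> t_prime R Q.
Proof.
move=> Mmax Qp QM Qx x0; have [_ Mp] := t_maximal_prime Mmax.
split=> //; apply/t_idealP; split; [by case: Qp|by exists x|].
move=> F FQ y Fy.
have Ry : R y by apply: vop_sub_dom Fy; exact: subset_trans FQ (prime_sub Qp).
have [[f Ff f0]|F0] := pselect (exists2 f, f \in F & f != 0); last first.
  rewrite (@colon_set0P y); first exact: prime0.
  move=> z; rewrite mulrC; apply: Fy => f Ff; rewrite (_ : f = 0) ?mulr0; first exact: dom0.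
  by apply/eqP/negP => /negP f0; apply: F0; exists f.
have [c [s [Fc c0 Rs Ms sF]]] := loc_dual Mp (pv Mmax) Ff f0.
have /(prime_or Qp Rs Ry)[/QM //|//] : Q (s * y).
rewrite (_ : s * y = (y * (s / c)) * c); last by field.
by apply: (prime_mull Qp); [exact: Fy|exact: FQ].
Qed.

Lemma t_prime_loc P : t_prime R P -> valuation_domain (loc R P).
Proof.
move=> /t_prime_maximal[M Mmax PM] x x0.
by have [|] := pv Mmax x0; [left|right]; exact: (locS PM).
Qed.

(** The element [s / c] of [loc_dual] works: [s] is a unit at [P], and [c], being in [P], is not. *)
Lemma t_prime_inv_notin_loc P (F : seq K) p : t_prime R P -> [set` F] `<=` P ->
  p \in F -> p != 0 -> exists2 y, colon R [set` F] y & ~ loc R P y.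
Proof.
move=> Pt FP Fp p0; have Pp := Pt.2.
have [c [s [Fc c0 Rs Ps sF]]] := loc_dual Pp (t_prime_loc Pt) Fp p0.
exists (s / c) => // /(locM Pp (locV Rs Ps)).
by rewrite mulrA mulVf ?mul1r; [apply: loc_nonunit => //; exact: FP|exact: notin_prime_neq0 Ps].
Qed.

(* The ideal (1, y) is t-invertible, so its inverse is of finite type. *)
Lemma conductor_finite y : exists2 G : seq K,
  [set` G] `<=` [set r | R r /\ R (y * r)] &
  [set r | R r /\ R (y * r)] `<=` vop R [set` G].
Proof.
pose C := [set r | R r /\ R (y * r)].
have C0 : C 0 by split; rewrite ?mulr0; exact: dom0.
have CD r s : C r -> C s -> C (r + s).
  by move=> [Rr yr] [Rs ys]; split; rewrite ?mulrDr; exact: domD.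
have CM r s : R r -> C s -> C (r * s).
  by move=> Rr [Rs ys]; split; rewrite ?[y * _]mulrCA; exact: domM.
(* [C] is the inverse of [(1, y)] and [A] is the product of the two; [A] lies in no t-maximal ideal,
   because [y] or [y^-1] is in each localization. *)
pose A := [set a | exists g h, [/\ C g, C h & a = g + y * h]].
have Aid : is_ideal R A.
  split=> [_ [g [h [[Rg _] [_ Rh] ->]]]||
    _ _ [g [h [Cg Ch ->]]] [k [l [Ck Cl ->]]]|r _ Rr [g [h [Cg Ch ->]]]].
  - exact: domD.
  - by exists 0, 0; split; rewrite ?mulr0 ?addr0.
  - by exists (g + k), (h + l); split; [exact: CD|exact: CD|ring].
  - by exists (r * g), (r * h); split; [exact: CM|exact: CM|ring].
have CA c : C c -> A c by move=> Cc; exists c, 0; split; rewrite ?mulr0 ?addr0.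
have yCA c : C c -> A (y * c) by move=> Cc; exists 0, c; split; rewrite ?add0r.
have An0 : A <> [set 0].
  have [a [b [Ra Rb b0 yE]]] := dom_frac y.
  by apply: (neq0_set _ b0); apply: CA; split=> //; rewrite yE divfK.
have At := top_t_ideal Aid An0.
have A1 : top R A 1.
  apply: contrapT => /(t_maximal_exists At)[M Mmax AM].
  have {AM}AM : A `<=` M by apply: subset_trans AM; exact: sub_top.
  have [_ Mp] := t_maximal_prime Mmax.
  have [y0|y0] := eqVneq y 0.
    by apply: (prime1 Mp); apply/AM/CA; split; [exact: dom1|rewrite y0 mul0r; exact: dom0].
  have [|] := pv Mmax y0 => /(loc_denom Mp)[s [Rs Ms Rsy]].
    by apply: Ms; apply/AM/CA; split; rewrite // mulrC.
  have ysE : y * (s / y) = s by rewrite mulrC divfK.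
  by apply: Ms; apply: AM; rewrite -ysE; apply: yCA; split; rewrite ?ysE.
have {A1} [F FA F1] := (topP 1 Aid An0).1 A1.
have [||G GC FG] := @seq_collect _ C
    (fun f G => exists g h, [/\ g \in G, h \in G & f = g + y * h]) F.
- by move=> f G H [g [h [Gg Gh ->]]] GH; exists g, h; split=> //; exact: GH.
- move=> f /FA[g [h [Cg Ch ->]]]; exists [:: g; h].
    by move=> z /=; rewrite !inE => /orP[]/eqP->.
  by exists g, h; rewrite !inE !eqxx orbT.
(* For [f = g + y * h] with [g], [h] in [G], the coefficients of [r * f = r * g + (r * y) * h] are
   in [R]; and [1] is in the v-closure of [F]. *)
exists G => // r [Rr yr]; rewrite -[r]mulr1; apply: vop_mul F1 => f /FG[g [h [Gg Gh ->]]].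
rewrite mulrDr mulrA [r * y]mulrC; apply: vopD; apply: vopZ => //; exact: sub_vop.
Qed.

End PvMD.

(** Stated for arbitrary sets, since the Cohen argument applies it to ideals that are not prime. *)
Definition t_radical_finite (L : set K) : Prop :=
  exists2 F : seq K, [set` F] `<=` L &
    forall Q, t_prime R Q -> [set` F] `<=` Q -> L `<=` Q.

Lemma t_prime_neq0 P : t_prime R P -> exists2 p, P p & p != 0.
Proof. by move=> [/t_idealP[]]. Qed.

Lemma t_prime_radical_finite_neq0 P : t_prime R P -> t_radical_finite P ->
  exists F : seq K, [/\ [set` F] `<=` P, exists2 p, p \in F & p != 0 &
    forall Q, t_prime R Q -> [set` F] `<=` Q -> P `<=` Q].
Proof.
move=> /t_prime_neq0[p Pp p0] [F FP FQ]; exists (p :: F); split.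
- by move=> x /=; rewrite inE => /orP[/eqP ->//|]; exact: FP.
- by exists p; rewrite ?inE ?eqxx.
- by move=> Q Qt FQ'; apply: FQ => // x Fx; apply: FQ'; rewrite /= inE; apply/orP; right.
Qed.

(** * Strongly discrete PvMDs: finiteness from the t##- and tRTP-properties *)

Section StronglyDiscrete.
Hypothesis sd : strongly_discrete_PvMD R.

Let pv : PvMD R. Proof. exact: sd.1. Qed.

(** If no element of [P] generated its localization, every [p] in [P] would lie in [P^2] locally, so
    that [P] would be the t-closure of [P^2]. *)
Lemma t_prime_loc_principal P : t_prime R P ->
  exists a, [/\ P a, a != 0 & forall p, P p -> loc R P (p / a)].
Proof.
move=> Pt; have Pp := Pt.2; have [Pid _ _] := Pp; have [PR P0 PD PM] := Pid; apply: contrapT => nP.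
have PPid : is_ideal R (mulsub P P).
  by apply: mulsub_ideal Pid _ => a b /PR Ra /PR; exact: domM.
have PPn0 : mulsub P P <> [set 0].
  have [p Pp' p0] := t_prime_neq0 Pt.
  by apply: (neq0_set (mulsubM Pp' Pp')); rewrite mulf_neq0.
apply: (sd.2 _ Pt); apply/seteqP; split.
  apply: top_sub => //; first by case: Pt.
  by apply: mulsub_sub => // a b /PR; exact: PM.
move=> p Pp'; have sPP := sub_top PPid PPn0.
have [->|p0] := eqVneq p 0; first by case: (top_t_ideal PPid PPn0) => -[].
(* Since [p] does not divide some [q] of [P] locally, [p = q * (b / s)] with [b] in [P]. *)
have [q Pq qp] : exists2 q, P q & ~ loc R P (q / p).
  apply: contrapT => nq; apply: nP; exists p; split=> // q Pq.
  by apply: contrapT => lq; apply: nq; exists q.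
have q0 : q != 0.
  by apply/eqP => q0; apply: qp; rewrite q0 mul0r; exact: (sub_loc Pp dom0).
have [|] := t_prime_loc pv Pt (mulf_neq0 q0 (invr_neq0 p0)); first by [].
rewrite invf_div => -[b [s [Rb Rs Ps pqE]]].
have s0 := notin_prime_neq0 Pp Ps.
have b0 : b != 0.
  apply/eqP => b0; move/eqP: pqE.
  by rewrite b0 mul0r mulf_eq0 invr_eq0 (negbTE p0) (negbTE q0).
have Pb : P b.
  apply: contrapT => Pb; apply: qp.
  by exists s, b; split=> //; rewrite -invf_div pqE invf_div.
apply: t_ideal_local (top_t_ideal PPid PPn0) _ => M Mmax.
have [_ Mp] := t_maximal_prime Mmax.
have [PM'|/existsNP[r /not_implyP[Pr Mr]]] := pselect (P `<=` M); last first.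
  by exists r; split=> //; [exact: PR|apply/sPP; exact: mulsubM].
(* If [b / s] is in the localization at [M], then [u * p] is [q] times an element of [P]; if its
   inverse is, [b] becomes a unit at [P]. *)
have [|] := pv Mmax (mulf_neq0 b0 (invr_neq0 s0)) => /(loc_denom Mp)[u [Ru Mu Rub]].
  exists u; split=> //; apply: sPP.
  rewrite (_ : u * p = q * (u * (b / s))); last by rewrite -pqE; field.
  apply: mulsubM => //.
  have /(prime_or Pp Rub Rs)[//|/Ps//] : P (u * (b / s) * s).
  by rewrite -mulrA divfK//; exact: PM.
exfalso; apply: (loc_nonunit Pp Pb b0).
rewrite (_ : b^-1 = s^-1 * (b / s)^-1); last by field; rewrite s0.
apply: (locM Pp); first exact: locV.
by apply: (locP Pp Ru) Rub => /PM'.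
Qed.

Lemma t_prime_radical_finite_of P y : t_prime R P -> ~ loc R P y ->
  (forall M, t_maximal R M -> ~ (P `<=` M) -> loc R M y) -> t_radical_finite P.
Proof.
move=> Pt Py yM; have Pp := Pt.2.
have [a [Pa a0 aP]] := t_prime_loc_principal Pt.
have [G GC CG] := conductor_finite pv y.
exists (a :: G) => [x /=|Q Qt FQ].
  rewrite inE => /orP[/eqP->//|/GC[Rx yx]]; apply: contrapT => Px; apply: Py.
  by apply: (locP Pp Rx Px); rewrite mulrC.
have Qp := Qt.2; have [M Mmax QM] := t_prime_maximal Qt.
have [_ Mp] := t_maximal_prime Mmax.
have /t_idealP[_ _ Qv] := Qt.1.
(* Otherwise the conductor of [y], contained in [Q] because [G] is, would have an element outside
   [M]. *)
have PM : P `<=` M.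
  apply: contrapT => /(yM M Mmax)/(loc_denom Mp)[s [Rs Ms Rsy]]; apply: Ms; apply: QM.
  apply: (Qv G) => [x Gx|]; first by apply: FQ; rewrite /= inE; apply/orP; right.
  by apply: CG; split=> //; rewrite mulrC.
have Qa : Q a by apply: FQ; rewrite /= inE eqxx.
move=> p Pp'; apply: contrapT => Qp'.
(* As [u * p] is a multiple of [a], it is in [Q]; so [u] is in [Q] but not in [P], and [p] in [P]
   but not in [Q], which is impossible for primes below [M]. *)
have [u [Ru Pu Rup]] := loc_denom Pp (aP _ Pp').
have Qu : Q u.
  have /(prime_or Qp Ru (prime_sub Pp Pp'))[//|/Qp'//] : Q (u * p).
  by rewrite -[p](divfK a0) mulrA; exact: (prime_mull Qp).
apply: Pu; exact: (valuation_comparable Mp (pv Mmax) Pp Qp PM QM Pp' Qp' Qu).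
Qed.

Lemma t_sharp_sharp_radical_finite P : t_sharp_sharp R -> t_prime R P ->
  t_radical_finite P.
Proof.
move=> sharp Pt; pose B := [set M | t_maximal R M /\ ~ (P `<=` M)].
pose A := [set X | X = P \/ B X].
have At Q : A Q -> t_prime R Q by move=> [->//|[/t_maximal_prime]].
(* No member of [B] contains [P], and one inside [P] equals it by t-maximality. *)
have Ainc : pairwise_incomparable A.
  move=> X Y AX [->|[Ymax YP]]; move: AX => [->|[[Xt XR Xmax] XP]] // XY.
    by apply/esym/Xmax => //; case: Pt => // _ [].
  by apply/esym/Xmax; case: Ymax.
have AB : A <> B.
  by move=> AB; have [_] : B P by [rewrite -AB; left]; apply.
have : \bigcap_(Q in A) loc R Q <> \bigcap_(Q in B) loc R Q.
  apply: sharp => //; first by move=> Q BQ; apply: At; right.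
  by move=> X Y BX BY; apply: Ainc; right.
apply: contra_notP => nfin; apply/seteqP; split=> y Ay Q.
  by move=> BQ; apply: Ay; right.
move=> [->|/Ay//]; apply: contrapT => Py; apply: nfin.
by apply: t_prime_radical_finite_of Pt Py _ => M Mmax PM; apply: Ay.
Qed.

Lemma tRTP_radical_finite P : tRTP R -> t_prime R P -> t_radical_finite P.
Proof.
move=> rtp Pt; have Pp := Pt.2; have [Pid _ _] := Pp; have [PR P0 PD PM] := Pid.
have [a [Pa a0 aP]] := t_prime_loc_principal Pt.
(* This is the trace of [P^2 R_P], because [a] generates [P R_P]. *)
pose I := [set r | R r /\ loc R P (r / a ^+ 2)].
have a20 : a ^+ 2 != 0 by rewrite expf_neq0.
have Isq p : P p -> I (p ^+ 2).
  move=> Pp'; split; first exact: domX (PR _ Pp').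
  by rewrite -expr_div_n expr2; apply: (locM Pp); exact: aP.
have Iid : is_ideal R I.
  split=> [r []//||r s [Rr Ir] [Rs Is]|r s Rr [Rs Is]].
  - by split; rewrite ?mul0r; [exact: dom0|exact: (sub_loc Pp dom0)].
  - by split; [exact: domD|rewrite mulrDl; exact: (locD Pp)].
  - by split; [exact: domM|rewrite -mulrA; apply: (locM Pp) => //; exact: (sub_loc Pp)].
have It : t_ideal R I.
  apply/t_idealP; split=> //; first by exists (a ^+ 2) => //; exact: Isq.
  move=> F FI x Fx; have [|s [Rs Ps sF]] := @loc_common_denom _ Pp [seq f / a ^+ 2 | f <- F].
    by move=> _ /= /mapP[f /FI[_ If] ->].
  split; first by apply: vop_sub_dom Fx => f /FI[].
  apply: (locP Pp Rs Ps); rewrite mulrCA; apply: Fx => f Ff.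
  by rewrite mulrAC -mulrA; apply: sF; exact: map_f.
(* If [(R : I)] were inside [R_P], then [I (R : I)] would be inside [I]. Either case of tRTP would
   then put [a] in [I], as its square is there, making [a] a unit at [P]. *)
have [y Iy Py] : exists2 y, colon R I y & ~ loc R P y.
  apply: contrapT => ny.
  have invP y : colon R I y -> loc R P y.
    by move=> Iy; apply: contrapT => Py; apply: ny; exists y.
  have I1 : colon R I 1 by move=> b [Rb _]; rewrite mul1r.
  have In0 : I <> [set 0] by case: It.
  have Sid : is_ideal R (mulsub I (colon R I)).
    by apply: mulsub_ideal => // x z Ix Iz; rewrite mulrC; exact: Iz.
  have Ssup : I `<=` mulsub I (colon R I).
    by move=> x Ix; rewrite -[x]mulr1; exact: mulsubM.
  have Sn0 : mulsub I (colon R I) <> [set 0].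
    by apply: (neq0_set (Ssup _ (Isq _ Pa))).
  have TI : top R (mulsub I (colon R I)) `<=` I.
    apply: top_sub => //; case: (Iid) => IR I0 ID IM.
    apply: mulsub_sub => // x z Ix Iz; split; first by rewrite mulrC; exact: Iz.
    by rewrite mulrAC; apply: (locM Pp); [case: Ix|exact: invP].
  have [_] : I a.
    apply: TI; have [->|[_ Trad]] := rtp I Iid In0; first exact: PR.
    by apply: (Trad a 2%N); [exact: PR|apply: sub_top => //; apply: Ssup; exact: Isq].
  rewrite (_ : a / a ^+ 2 = a^-1); last by field.
  exact: loc_nonunit.
apply: t_prime_radical_finite_of Pt Py _ => M Mmax /existsNP[p /not_implyP[Pp' Mp']].
have [_ Mp] := t_maximal_prime Mmax.
apply: (locP Mp (domX 2 (PR _ Pp'))); first by move=> /(prime_exp Mp (PR _ Pp')).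
by rewrite mulrC; apply: Iy; exact: Isq.
Qed.

End StronglyDiscrete.

(** * From finiteness back to the t##- and tRTP-properties *)

Lemma radical_finite_sharp : PvMD R ->
  (forall P, t_prime R P -> t_radical_finite P) -> t_sharp_sharp R.
Proof.
move=> pv fin.
(* An element of [(R : F)] outside [R_P] lies in [R_Q] whenever [Q] misses an element of [F], so
   equal intersections force some [Q] of [B] to contain [P]. *)
have dom (A B : set (set K)) P : (forall Q, A Q -> t_prime R Q) ->
    (forall Q, B Q -> t_prime R Q) ->
    \bigcap_(Q in A) loc R Q = \bigcap_(Q in B) loc R Q -> A P ->
    exists2 Q, B Q & P `<=` Q.
  move=> At Bt AB AP; apply: contrapT => nB; have Pt := At _ AP.
  have [F [FP [p Fp p0] FQ]] := t_prime_radical_finite_neq0 Pt (fin _ Pt).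
  have [y Fy Py] := t_prime_inv_notin_loc pv Pt FP Fp p0.
  have : (\bigcap_(Q in B) loc R Q) y.
    move=> Q BQ; apply: contrapT => Qy; apply: nB; exists Q => //.
    apply: FQ => [|f Ff]; first exact: Bt.
    apply: contrapT => Qf; apply: Qy; apply: (locP (Bt _ BQ).2 _ Qf).
      by apply: (prime_sub Pt.2); exact: FP.
    by rewrite mulrC; exact: Fy.
  by rewrite -AB => /(_ P AP).
have sub (A B : set (set K)) : (forall Q, A Q -> t_prime R Q) ->
    (forall Q, B Q -> t_prime R Q) -> pairwise_incomparable A ->
    \bigcap_(Q in A) loc R Q = \bigcap_(Q in B) loc R Q -> A `<=` B.
  move=> At Bt Ainc AB P AP.
  have [Q BQ PQ] := dom A B P At Bt AB AP.
  have [P' AP' QP'] := dom B A Q Bt At (esym AB) BQ.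
  have PP' : P = P' by apply: Ainc => //; exact: subset_trans QP'.
  by rewrite (_ : P = Q)//; apply/seteqP; split => //; rewrite PP'.
by move=> A B At Bt Ainc Binc AB cap; apply: AB; apply/seteqP; split; exact: sub.
Qed.

(* At a t-maximal ideal M, the overring (T_M : T_M) of loc R M is loc R Q for a
   t-prime Q.  If T were inside Q^2 loc R Q, a finite set with radical Q would
   have an inverse inside (R : T) = (T : T), hence inside loc R Q, which is
   impossible.  So T_M contains Q loc R Q, which is prime. *)
Lemma radical_finite_tRTP : strongly_discrete_PvMD R ->
  (forall P, t_prime R P -> t_radical_finite P) -> tRTP R.
Proof.
move=> sd fin I Iid In0; right; have pv := sd.1.
have [IR I0 ID IM] := Iid.
set S := mulsub I (colon R I); set T := top R S.
have I1 : colon R I 1 by move=> b /IR; rewrite mul1r.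
have Sid : is_ideal R S by apply: mulsub_ideal => // x z Ix Iz; rewrite mulrC; exact: Iz.
have Sn0 : S <> [set 0].
  have [x Ix x0] := ideal_neq0 Iid In0.
  by apply: (@neq0_set _ (x * 1)); rewrite ?mulr1//; rewrite -[x]mulr1; exact: mulsubM.
have Tt : t_ideal R T := top_t_ideal Sid Sn0.
have ST : S `<=` T := sub_top Sid Sn0.
have [Tid _ _] := Tt; have [TR T0 TD TM] := Tid.
(* An element of [(R : T)] multiplies [(R : I)] into itself, since [I (R : I)] is inside [T]; hence
   it multiplies [T] into [T]. *)
have Tinv y t : colon R T y -> T t -> T (y * t).
  move=> Ty; have yS s : S s -> S (y * s).
    case: (Sid) => _ S0 SD _; move: s; apply: mulsub_sub; rewrite ?mulr0//.
      by move=> s s' Ss Ss'; rewrite mulrDr; exact: SD.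
    move=> i z Ii Iz; rewrite mulrCA; apply: mulsubM => // j Ij.
    by rewrite -mulrA [z * j]mulrC; apply/Ty/ST; exact: mulsubM.
  move=> /(topP _ Sid Sn0)[F FS Ft]; apply/topP => //.
  exists [seq y * f | f <- F]; first by move=> _ /= /mapP[f /FS Sf ->]; exact: yS.
  by apply: vop_mul Ft => f Ff; apply: sub_vop; exact: map_f.
split=> // x n Rx Txn; apply: t_ideal_local Tt _ => M Mmax.
have [_ Mp] := t_maximal_prime Mmax; have Mval := pv _ Mmax.
(* [TM'] is the extension of [T] to [loc R M], and [W] below is its ring of multipliers. *)
pose TM' := [set y | exists s, [/\ R s, ~ M s & T (s * y)]].
have TTM : T `<=` TM'.
  by move=> t Tt'; exists 1; split; [exact: dom1|exact: prime1|rewrite mul1r].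
have TM'D y z : TM' y -> TM' z -> TM' (y + z).
  move=> [s [Rs Ms Ty]] [u [Ru Mu Tz]]; exists (s * u).
  split; [exact: domM|exact: (prime_mulN Mp)|].
  by rewrite mulrDr; apply: TD; [rewrite mulrAC mulrC|rewrite -mulrA]; exact: TM.
have TM'M r y : loc R M r -> TM' y -> TM' (r * y).
  move=> /(loc_denom Mp)[s [Rs Ms Rsr]] [u [Ru Mu Ty]]; exists (s * u).
  by split; [exact: domM|exact: (prime_mulN Mp)|rewrite mulrACA; exact: TM].
pose W := [set y | forall t, TM' t -> TM' (y * t)].
have MW : loc R M `<=` W by move=> r Mr t; exact: TM'M.
have RW : R `<=` W by move=> r Rr; apply/MW/(sub_loc Mp).
have WD y z : W y -> W z -> W (y + z).
  by move=> Wy Wz t Tt'; rewrite mulrDl; apply: TM'D; [exact: Wy|exact: Wz].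
have WM y z : W y -> W z -> W (y * z).
  by move=> Wy Wz t Tt'; rewrite -mulrA; apply/Wy/Wz.
have Qp := center_prime Mp Mval MW WD WM; have QM := center_sub Mp MW.
have QW := loc_center Mp Mval MW WD WM; set Q := center W in Qp QM QW.
have invW y : colon R T y -> W y.
  move=> Ty t [s [Rs Ms Tst]]; exists s; split=> //.
  by rewrite mulrCA; exact: Tinv.
apply: contrapT => Tx; have {}Tx : ~ TM' x by [].
have xW t w : TM' t -> W w -> x = w * t -> False.
  by move=> Tt' Ww xE; apply: Tx; rewrite xE; exact: Ww.
(* Were [x] a unit of [loc R Q = W], then [x ^+ n] in [T] would give [x] in [TM']. *)
have Qx : Q x.
  apply: contrapT => Qx; have Wxn : W (x / x ^+ n).
    by rewrite -QW; exists x, (x ^+ n); split=> //; [exact: domX|move=> /(prime_exp Qp Rx)].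
  apply: (xW _ _ (TTM _ Txn) Wxn); rewrite divfK// expf_neq0//.
  exact: notin_prime_neq0 Qx.
have x0 : x != 0 by apply/eqP => x0; apply: Tx; rewrite x0; exact: TTM.
have Qt : t_prime R Q := prime_t_prime pv Mmax Qp QM Qx x0.
have [a [Qa a0 aQ]] := t_prime_loc_principal sd Qt.
have [t Tt' Qt'] : exists2 t, T t & ~ loc R Q (t / a ^+ 2).
  apply: contrapT => nT.
  have {nT}TQ t : T t -> loc R Q (t / a ^+ 2).
    by move=> Tt'; apply: contrapT => nt; apply: nT; exists t.
  have [F FQ FQ'] := fin _ Qt.
  have [|||y Fy Qy] := @t_prime_inv_notin_loc pv Q (a :: F) a Qt.
  - by move=> z /=; rewrite inE => /orP[/eqP->//|]; exact: FQ.
  - by rewrite inE eqxx.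
  - by [].
  apply: Qy; rewrite QW; apply: invW => t Tt'.
  apply: t_ideal_local t_ideal_dom _ => N Nmax; have [_ Np] := t_maximal_prime Nmax.
  suff /(loc_denom Np)[s [Rs Ns Rs']] : loc R N (y * t) by exists s.
  (* If [N] does not contain [Q], it misses an element of [F], which is then a denominator for
     [y]. *)
  have [QN|QN] := pselect (Q `<=` N); last first.
    apply: (locM Np); last exact: (sub_loc Np (TR _ Tt')).
    have /existsNP[j /not_implyP[Fj Nj]] : ~ [set` F] `<=` N.
      by move=> FN; apply: QN; apply: FQ' => //; exact: t_maximal_prime.
    apply: (locP Np _ Nj); first by apply: (prime_sub Qp); exact: FQ.
    by rewrite mulrC; apply: Fy; rewrite /= inE Fj orbT.
  rewrite (_ : y * t = y * a * (a * (t / a ^+ 2))); last by field.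
  apply: (locM Np); first by apply: (sub_loc Np); apply: Fy; rewrite /= inE eqxx.
  have [->|t0] := eqVneq t 0; first by rewrite mul0r mulr0; exact: (sub_loc Np dom0).
  set v := t / a ^+ 2; have v0 : v != 0 by rewrite mulf_neq0 ?invr_neq0 ?expf_neq0.
  (* If [a * v] were not in [loc R N], its inverse times [v] would put [a^-1] in [loc R Q]. *)
  have [//|/(locS QN) Qav] := pv _ Nmax _ (mulf_neq0 a0 v0).
  exfalso; apply: (loc_nonunit Qp Qa a0).
  rewrite (_ : a^-1 = v * (a * v)^-1); last by field; rewrite v0.
  by apply: (locM Qp) => //; exact: TQ.
have t0 : t != 0.
  by apply/eqP => t0; apply: Qt'; rewrite t0 mul0r; exact: (sub_loc Qp dom0).
(* Here [a^2 / t = b / s] with [b] in [Q], since [t / a^2] is not in [loc R Q]; thus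
   [a / t = s^-1 * (b / a)]. *)
have Wat : W (a / t).
  have [//|] := t_prime_loc pv Qt (mulf_neq0 (expf_neq0 2 a0) (invr_neq0 t0)); last first.
    by rewrite invf_div.
  move=> [b [s [Rb Rs Qs atE]]]; have s0 := notin_prime_neq0 Qp Qs.
  have [Qb|Qb] := pselect (Q b); last first.
    case: Qt'; exists s, b; split=> //.
    by rewrite -invf_div atE invf_div.
  rewrite -QW (_ : a / t = s^-1 * (b / a)); last first.
    rewrite mulrA [_ * b]mulrC -atE; field.
    by rewrite ?a0 ?t0.
  by apply: (locM Qp); [exact: locV|exact: aQ].
have Wxa : W (x / a) by rewrite -QW; exact: aQ.
apply: (xW _ _ (TTM _ Tt') (WM _ _ Wxa Wat)).
by field; rewrite t0 a0.
Qed.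

(** * Radical t-ideals and the ascending chain condition *)

Lemma radical_t_ideal_avoid (L : set K) x : PvMD R -> t_ideal R L ->
  radical_ideal R L -> R x -> ~ L x ->
  exists Q, [/\ t_prime R Q, L `<=` Q & ~ Q x].
Proof.
move=> pv Lt [[LR L0 LD LM] Lrad] Rx Lx.
have [M Mmax AM] : exists2 M, t_maximal R M & [set r | R r /\ L (r * x)] `<=` M.
  by apply: t_maximal_exists (t_ideal_colon x Lt) _ => -[_]; rewrite mul1r.
have [_ Mp] := t_maximal_prime Mmax; have Mval := pv _ Mmax.
have x0 : x != 0 by apply/eqP => x0; apply: Lx; rewrite x0.
(* Inverting [x] in [loc R M] gives an overring whose center avoids [x]. *)
pose W := [set y | exists n, loc R M (x ^+ n * y)].
have MW : loc R M `<=` W by move=> y My; exists 0%N; rewrite mul1r.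
have Mxn n y : loc R M y -> loc R M (x ^+ n * y).
  by move=> My; apply: (locM Mp) => //; apply: (sub_loc Mp); exact: domX.
have WD y z : W y -> W z -> W (y + z).
  move=> [n My] [m Mz]; exists (n + m)%N; rewrite mulrDr; apply: (locD Mp).
    by rewrite exprD mulrAC mulrC; exact: Mxn.
  by rewrite exprD -mulrA; exact: Mxn.
have WM y z : W y -> W z -> W (y * z).
  by move=> [n My] [m Mz]; exists (n + m)%N; rewrite exprD mulrACA; exact: (locM Mp).
have Qp := center_prime Mp Mval MW WD WM; have QM := center_sub Mp MW.
have LQ : L `<=` center W.
  move=> r Lr; split; first exact: LR.
  have [->|r0] := eqVneq r 0; first by left.
  right=> -[n /(loc_denom Mp)[s [Rs Ms Rsx]]].
  (* The power [(s * x) ^+ n.+1] is a multiple of [r], so [s * x] is in the radical ideal [L]. *)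
  apply: Ms; apply: AM; split=> //; apply: (Lrad _ n.+1); first exact: domM.
  rewrite exprMn_comm; last exact: mulrC.
  rewrite exprS exprS (_ : _ * _ = s ^+ n * x * (s * (x ^+ n / r)) * r); last by field.
  apply: LM => //; apply: domM => //; apply: domM => //; exact: domX.
have /t_idealP[_ [p Lp p0] _] := Lt.
exists (center W); split=> //; first exact: (prime_t_prime pv Mmax Qp QM (LQ _ Lp) p0).
move=> [_ [/eqP|]]; first by rewrite (negbTE x0).
by apply; exists 1%N; rewrite expr1 divff//; exact: (sub_loc Mp dom1).
Qed.

Lemma radical_finite_ideal : (forall P, t_prime R P -> t_radical_finite P) ->
  forall L, is_ideal R L -> t_radical_finite L.
Proof.
move=> fin L0 L0id; apply: contrapT => L0nf.
have [//|C C0 CP Ctot|L [[Lid Lnf] _ Lmax]] :=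
    @Zorn_above _ [set X | is_ideal R X /\ ~ t_radical_finite X] L0.
  split; first by apply: ideal_bigcup => // X /CP[].
  move=> [F /(chain_seq C0 Ctot)[X CX FX] FQ]; have [_] := CP _ CX; apply.
  exists F => // Q Qt FQ'; apply: subset_trans (FQ Q Qt FQ').
  by move=> x Xx; exists X.
have [LR L0' LD LM] := Lid.
have big A : is_ideal R A -> L `<=` A -> A <> L -> t_radical_finite A.
  by move=> Aid LA AL; apply: contrapT => Anf; apply: AL; exact: Lmax.
have Ln0 : L <> [set 0].
  move=> Lz; apply: Lnf; exists [::] => // Q [_ Qp] _; rewrite Lz => _ ->.
  exact: prime0.
have LR' : L <> R.
  move=> LR'; apply: Lnf; exists [:: 1] => [z /=|Q [_ Qp] Q1].
    by rewrite inE => /eqP ->; rewrite LR'; exact: dom1.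
  by case: (prime1 Qp); apply: Q1; rewrite /= inE.
have Lt : t_ideal R L.
  (* A strictly larger t-closure would satisfy the finiteness, and its finite set lies in the
     v-closure of a finite subset of [L]. *)
  split=> //; apply: contrapT => tL; apply: Lnf.
  have [tLid _ _] := top_t_ideal Lid Ln0.
  have [F FtL FQ] := big _ tLid (sub_top Lid Ln0) tL.
  have [x Fx|G GL FG] := @vop_seq_collect L F; first by apply/topP => //; exact: FtL.
  exists G => // Q Qt GQ; apply: subset_trans (sub_top Lid Ln0) _; apply: FQ => // x Fx.
  by have /t_idealP[_ _ Qv] := Qt.1; apply: (Qv G) => //; apply/FG/sub_vop.
have addid a : R a -> is_ideal R [set z | exists l r, [/\ L l, R r & z = l + r * a]].
  move=> Ra; split=> [_ [l [r [Ll Rr ->]]]||_ _ [l [r [Ll Rr ->]]] [m [s [Lm Rs ->]]]|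
      s _ Rs [l [r [Ll Rr ->]]]].
  - by apply: domD; [exact: LR|exact: domM].
  - by exists 0, 0; split; [|exact: dom0|rewrite mul0r addr0].
  - by exists (l + m), (r + s); split; [exact: LD|exact: domD|ring].
  - by exists (s * l), (s * r); split; [exact: LM|exact: domM|ring].
have finadd a : R a -> ~ L a -> exists2 F : seq K, [set` F] `<=` L &
    forall Q, t_prime R Q -> [set` F] `<=` Q -> Q a -> L `<=` Q.
  move=> Ra La; have LA l : L l -> exists m r, [/\ L m, R r & l = m + r * a].
    by exists l, 0; split; [|exact: dom0|rewrite mul0r addr0].
  have [|F FA FQ] := big _ (addid a Ra) LA.
    move=> AL; apply: La; rewrite -AL; exists 0, 1.
    by split; [|exact: dom1|rewrite mul1r add0r].
  have [z G H [l [r [Gl Rr ->]]] GH|z /FA[l [r [Ll Rr ->]]]|G GL FG] := @seq_collect _ L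
      (fun z G => exists l r, [/\ l \in G, R r & z = l + r * a]) F.
  - by exists l, r; split=> //; exact: GH.
  - exists [:: l]; first by move=> y /=; rewrite inE => /eqP->.
    by exists l, r; rewrite inE eqxx.
  - exists G => // Q Qt GQ Qa; apply: subset_trans (LA) _; apply: FQ => // z.
    move=> /FG[l [r [Gl Rr ->]]]; apply: (prime_add Qt.2); first exact: GQ.
    exact: (prime_mull Qt.2).
suff Lp : t_prime R L by apply: Lnf; exact: fin.
split=> //; split=> // a b Ra Rb Lab; apply: contrapT => /not_orP[La Lb].
have [F FL FQ] := finadd a Ra La; have [G GL GQ] := finadd b Rb Lb.
(* A t-prime containing [a * b] contains [a] or [b]; then [F] or [G] forces [L] into it. *)
apply: Lnf; exists (a * b :: F ++ G).
  by move=> x /=; rewrite inE mem_cat => /or3P[/eqP->//|/FL|/GL].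
move=> Q Qt HQ; have FQ' : [set` F] `<=` Q.
  by move=> x Fx; apply: HQ; rewrite /= inE mem_cat; apply/or3P/Or32.
have GQ' : [set` G] `<=` Q.
  by move=> x Fx; apply: HQ; rewrite /= inE mem_cat; apply/or3P/Or33.
have /(prime_or Qt.2 Ra Rb)[Qa|Qb] : Q (a * b) by apply: HQ; rewrite /= inE eqxx.
  exact: FQ.
exact: GQ.
Qed.

(** A finite set for the union lies in some [I N], so each t-prime over [I N] contains the union;
    but an element of the union outside [I N] would be avoided by such a t-prime. *)
Lemma radical_finite_acc : PvMD R ->
  (forall P, t_prime R P -> t_radical_finite P) -> acc_radical_t_ideals R.
Proof.
move=> pv fin I It Imono; pose J := \bigcup_(X in range I) X.
have IS m n : (m <= n)%N -> I m `<=` I n.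
  elim: n => [|n IHn]; first by rewrite leqn0 => /eqP->.
  rewrite leq_eqVlt => /orP[/eqP->//|]; rewrite ltnS => /IHn mn.
  exact: subset_trans (Imono n).
have I0 : range I !=set0 by exists (I 0%N), 0%N.
have Itot : total_on (range I) subset.
  by move=> _ _ [m _ <-] [n _ <-]; have [/IS|/ltnW/IS] := leqP m n; [left|right].
have Jid : is_ideal R J.
  by apply: ideal_bigcup => // _ [n _ <-]; have [_ []] := It n.
have [F /(chain_seq I0 Itot)[_ [N _ <-] FN] FQ] := radical_finite_ideal fin Jid.
exists N => n Nn; apply/seteqP; split; last exact: IS.
move=> x Inx; apply: contrapT => INx; have [INt INrad] := It N.
have [|Q [Qt NQ Qx]] := radical_t_ideal_avoid pv INt INrad _ INx.
  by have [_ [[InR _ _ _] _]] := It n; exact: InR.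
apply: Qx; apply: (FQ Q Qt); first exact: subset_trans NQ.
by exists (I n) => //; exists n.
Qed.

Lemma acc_radical_finite P : acc_radical_t_ideals R -> t_prime R P ->
  t_radical_finite P.
Proof.
move=> acc Pt; apply: contrapT => nfin; have [p Pp p0] := t_prime_neq0 Pt.
have PR := prime_sub Pt.2.
(* The value is arbitrary when [F] is not inside [P]; otherwise it is an element of [P] missed by a
   t-prime over [F]. *)
have /choice[f fP] (F : seq K) : exists x, [set` F] `<=` P ->
    P x /\ exists Q, [/\ t_prime R Q, [set` F] `<=` Q & ~ Q x].
  apply: contrapT => /forallNP nx; apply: nfin.
  have FP : [set` F] `<=` P by apply: contrapT => nFP; apply: (nx 0) => /nFP.
  exists F => // Q Qt FQ x Px; apply: contrapT => Qx.
  by apply: (nx x) => _; split=> //; exists Q.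
pose F n := iter n (fun G => f G :: G) [:: p].
have FP n : [set` F n] `<=` P.
  elim: n => [|n IHn] x /=; first by rewrite inE => /eqP->.
  by rewrite inE => /orP[/eqP->|]; [case: (fP _ IHn)|exact: IHn].
have Fp n : p \in F n by elim: n => [|n IHn]; rewrite /= inE ?eqxx// IHn orbT.
(* An intersection of t-primes with [R], hence a radical t-ideal; it is nonzero because the lists
   start from [p]. *)
pose I n := [set r | R r /\ forall Q, t_prime R Q -> [set` F n] `<=` Q -> Q r].
have Iid n : is_ideal R (I n).
  split=> [r []//||r s [Rr Ir] [Rs Is]|r s Rr [Rs Is]].
  - by split=> [|Q [_ Qp] _]; [exact: dom0|exact: prime0].
  - split=> [|Q Qt FQ]; first exact: domD.
    by apply: (prime_add Qt.2); [exact: Ir|exact: Is].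
  - split=> [|Q Qt FQ]; first exact: domM.
    by apply: (prime_mull Qt.2) => //; exact: Is.
have [n|n|N IN] := acc I.
- split; [apply/t_idealP; split=> //|split=> // x m Rx [_ Im]].
  + by exists p => //; split=> [|Q _]; [exact: PR|apply; exact: Fp].
  + move=> G GI x Gx; split; first by apply: vop_sub_dom Gx => g /GI[].
    move=> Q Qt FQ; have /t_idealP[_ _ Qv] := Qt.1.
    by apply: (Qv G) => // g /GI[_]; apply.
  + by split=> // Q Qt FQ; apply: (prime_exp Qt.2 Rx); exact: Im.
- move=> r [Rr Ir]; split=> // Q Qt FQ; apply: Ir => // x Fx.
  by apply: FQ; rewrite /= inE; apply/orP; right.
have [Pf [Q [Qt FQ Qf]]] := fP _ (FP N).
have : I N.+1 (f (F N)).
  by split=> [|Q' _]; [exact: PR|apply; rewrite /= inE eqxx].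
by rewrite (IN _ (leqnSn N)) => -[_ /(_ Q Qt FQ)].
Qed.

End Domain.

Theorem theorem1p14 (K : fieldType) (R : set K) :
  domain_with_qf R ->
  [<-> generalized_Krull R;
       strongly_discrete_PvMD R /\ t_sharp_sharp R;
       strongly_discrete_PvMD R /\ tRTP R].
Proof.
move=> HR; tfae => [[sd acc]|[sd sharp]|[sd rtp]]; split=> //.
- by apply: radical_finite_sharp (sd.1) _ => // P; exact: acc_radical_finite.
- by apply: radical_finite_tRTP => // P; exact: t_sharp_sharp_radical_finite.
- by apply: radical_finite_acc (sd.1) _ => // P; exact: tRTP_radical_finite.
Qed.
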